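(* Let $k\geq 2$ and $m\geq 4$ be integers, let $\varepsilon>0$ and $C>1$ be fixed, and let $H$ be a linear $k$-uniform connector-free hypergraph on $m$ vertices. Then there exists $\delta>0$ such that the following holds for every function $p=p(n)$ with $p\gg n^{-1/D_H}$ (i.e. $p\,n^{1/D_H}\to\infty$) and $p=o(1)$, and for every sufficiently large $n$: if $G$ is an $n$-vertex $k$-uniform hypergraph that is $(D_H,C,2,\delta,p)$-pseudorandom, then \[ \big||\mathcal{E}(H,G)| - n^{m}p^{e(H)}\big| < \varepsilon\, n^{m}p^{e(H)}. \]
   Context: All hypergraphs are $k$-uniform (edges are $k$-element sets of vertices). A hypergraph is linear if any two distinct edges share at most one vertex. An edge $e$ of a linear $k$-uniform hypergraph $H$ is a connector if there exist a vertex $v\in V(H)\setminus e$ and $k$ edges $e_1,\dots,e_k$ all containing $v$ with $|e\cap e_i|=1$ for $1\le i\le k$; $H$ is connector-free if it has no connector. For a $k$-uniform hypergraph $H$, $d_H=\max\{\delta(J): J\subseteq H\}$ (maximum over subhypergraphs $J$ of the minimum vertex degree of $J$) and $D_H=\min\{k\,d_H,\Delta(H)\}$, where $\Delta(H)$ is the maximum vertex degree. An embedding of $H$ into $G$ is an injective map $\phi:V(H)\to V(G)$ such that $\{\phi(v_1),\dots,\phi(v_k)\}\in E(G)$ whenever $\{v_1,\dots,v_k\}\in E(H)$; $\mathcal{E}(H,G)$ is the set of all embeddings of $H$ into $G$, and $e(H)=|E(H)|$. For an $n$-vertex $k$-uniform hypergraph $G=(V,E)$ and $S\in\binom{V}{k-1}$,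 let $N_G(S)=\{x\in V: S\cup\{x\}\in E\}$. $G$ satisfies $\mathrm{BDD}(d,C,p)$ if for all $1\le r\le d$ and all distinct $S_1,\dots,S_r\in\binom{V}{k-1}$ we have $|N_G(S_1)\cap\dots\cap N_G(S_r)|\le Cnp^r$. $G$ satisfies $\mathrm{TUPLE}(d,\delta,p)$ if for every $1\le r\le d$, the inequality $\big||N_G(S_1)\cap\dots\cap N_G(S_r)|-np^r\big|<\delta np^r$ holds for all but at most $\delta\binom{\binom{n}{k-1}}{r}$ families $\{S_1,\dots,S_r\}$ of $r$ distinct sets of $\binom{V}{k-1}$. $G$ is $(d_1,C,d_2,\delta,p)$-pseudorandom if $|E|=p\binom{n}{k}$ and $G$ satisfies $\mathrm{BDD}(d_1,C,p)$ and $\mathrm{TUPLE}(d_2,\delta,p)$. *)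

(* Defs.v *)
From HB Require Import structures.
From mathcomp Require Import all_boot all_order all_algebra.
From mathcomp Require Import reals.

Set Implicit Arguments.
Unset Strict Implicit.
Unset Printing Implicit Defensive.

Import Order.TTheory GRing.Theory Num.Theory.

Local Open Scope ring_scope.
Local Open Scope set_scope.

(* A hypergraph with vertex set the finite type T is given by its edge set    *)
(* E : {set {set T}}.                                                         *)

Section Hypergraph.
Variable T : finType.
Implicit Types (E F : {set {set T}}) (W e : {set T}) (v : T).

Definition uniform (k : nat) E : Prop :=
  forall e : {set T}, e \in E -> #|e| = k.

Definition linear_hypergraph E : Prop :=
  forall e f : {set T}, e \in E -> f \in E -> e != f -> (#|e :&: f| <= 1)%N.

(* The k edges e_1, ..., e_k are pairwise distinct; they form the set F. *)
Definition connector (k : nat) E e : Prop :=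
  e \in E /\
  exists v : T, v \notin e /\
  exists F : {set {set T}},
    [/\ F \subset E, #|F| = k &
        forall f : {set T}, f \in F -> v \in f /\ #|e :&: f| = 1%N].

Definition connector_free (k : nat) E : Prop :=
  forall e : {set T}, ~ connector k E e.

Definition vdeg E v : nat := #|[set e in E | v \in e]|.

Definition max_deg E : nat := \max_(v : T) vdeg E v.

(* A subhypergraph J is a pair (vertex set, edge set) with nonempty vertex    *)
(* set; an induced choice of edges is not required.                           *)
Definition subhypergraph E (J : {set T} * {set {set T}}) : bool :=
  [&& J.1 != set0, J.2 \subset E & [forall e in J.2, e \subset J.1]].

(* The default value #|J.2| bounds every degree in J, so it does not affect   *)
(* the minimum when J.1 is nonempty.                                          *)
Definition min_deg (J : {set T} * {set {set T}}) : nat :=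
  \big[minn/#|J.2|]_(v in J.1) vdeg J.2 v.

Definition d_H E : nat :=
  \max_(J : {set T} * {set {set T}} | subhypergraph E J) min_deg J.

Definition D_H (k : nat) E : nat := minn (k * d_H E) (max_deg E).

Definition nbhd E (S : {set T}) : {set T} := [set x : T | S :|: [set x] \in E].

Definition common_nbhd E (F : {set {set T}}) : {set T} :=
  \bigcap_(S in F) nbhd E S.

(* families of r distinct (k-1)-element sets of vertices *)
Definition families (k r : nat) : {set {set {set T}}} :=
  [set F : {set {set T}} | (#|F| == r) && [forall S in F, #|S| == k.-1]].

Variable R : realType.

Definition BDD (k : nat) E (d : nat) (C p : R) : Prop :=
  forall r : nat, (1 <= r <= d)%N ->
  forall F : {set {set T}}, F \in families k r ->
    #|common_nbhd E F|%:R <= C * #|T|%:R * p ^+ r.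

Definition TUPLE (k : nat) E (d : nat) (delta p : R) : Prop :=
  forall r : nat, (1 <= r <= d)%N ->
    #|[set F in families k r |
        ~~ (`| #|common_nbhd E F|%:R - #|T|%:R * p ^+ r |
              < delta * #|T|%:R * p ^+ r)]|%:R
    <= delta * 'C('C(#|T|, k.-1), r)%:R.

Definition pseudorandom (k : nat) E (d1 : nat) (C : R) (d2 : nat)
    (delta p : R) : Prop :=
  [/\ #|E|%:R = p * 'C(#|T|, k)%:R, BDD k E d1 C p & TUPLE k E d2 delta p].

End Hypergraph.

Definition embeddings (T V : finType) (H : {set {set T}}) (G : {set {set V}})
    : {set {ffun T -> V}} :=
  [set phi : {ffun T -> V} |
     injectiveb phi && [forall e in H, phi @: e \in G]].

(* Main.v *)
(* A second moment argument derives TUPLE(r) for all r <= D_H from TUPLE(2) and *)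
(* BDD: the first two moments of the size of a common neighbourhood of r sets   *)
(* are sums of r-th powers of degrees and of codegrees, and the codegrees are   *)
(* bounded by BDD and concentrated by TUPLE(2).                                 *)
(* Embeddings are counted by removing a vertex v of degree at most d_H in the   *)
(* current subhypergraph. A typical embedding of the rest extends to v in about *)
(* n p^r ways, so it remains to see that few embeddings send the link of v to   *)
(* an atypical family. Place the vertex set N of the link first. It spans no    *)
(* edge since H is connector-free, and the other vertices can be ordered with   *)
(* at most d_H backward edges avoiding N and, by linearity, at most             *)
(* |N| <= (k - 1) d_H backward edges meeting N. Hence BDD(D_H) bounds the       *)
(* number of ways to complete the embedding.                                    *)

Require Import Defs.
From HB Require Import structures.
From mathcomp Require Import all_boot all_order all_algebra.
From mathcomp Require Import reals zify ring lra.

Set Implicit Arguments.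
Unset Strict Implicit.
Unset Printing Implicit Defensive.

Import Order.TTheory GRing.Theory Num.Theory.

Local Open Scope ring_scope.
Local Open Scope set_scope.

(** Adding a vertex [v] with [r] edges into the part already embedded should multiply the number of
    embeddings by n p^r; multiplying these factors gives n^m p^{e(H)}. Two obstacles arise. The
    hypothesis controls common neighbourhoods of pairs only, while [r] may be as large as d_H. And
    partial embeddings are a vanishing fraction of all maps, so a small set of atypical families
    could still receive a large share of them.

    The first obstacle is met by [atypical_rare], a Chebyshev argument. Up to the factor r!, the
    first moment is bounded below by convexity from the degree sum, and the second is bounded above
    because codegrees are at most a constant times p^2 C(n, k-1) and concentrate there in mean
    square; the main terms cancel in the variance.

    The second is met by [card_pemb_atypical]. Whether the family is atypical depends only on the
    images of the vertex set N of the link, and few maps make it so ([card_link_image_in]). As N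
    spans no edge ([inner_cover_punctured]), every edge is completed at a vertex outside N, and
    [ex_low_star_relative] orders these vertices so that each completes at most D_H edges. BDD then
    supplies every factor p ([card_pemb_extend]), and the atypical maps number O(eps) times the main
    term. [card_pemb_asymp] runs the induction over vertices. *)

Lemma leq_ffact_exp (n j : nat) : (n ^_ j <= n ^ j)%N.
Proof.
elim: j => [|j IH]; first by rewrite ffactn0.
by rewrite ffactnSr expnSr leq_mul // leq_subr.
Qed.

Lemma leq_bin_exp (n j : nat) : ('C(n, j) <= n ^ j)%N.
Proof.
apply: leq_trans (leq_ffact_exp n j); rewrite -bin_ffact.
by rewrite leq_pmulr // fact_gt0.
Qed.

Lemma leq_bin_self (n j : nat) : (0 < j < n)%N -> (n <= 'C(n, j))%N.
Proof.
elim: n j => [|n IH] [|j] //=; rewrite binS.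
case: (ltngtP j.+1 n) => [lt_jn|gt_jn|<-] jn; last by rewrite binn binSn.
- have := IH j.+1; rewrite lt_jn /= => /(_ isT).
  have: (0 < 'C(n, j))%N by rewrite bin_gt0; lia.
  lia.
- lia.
Qed.

Lemma leq_exp_sub_ffact (d r : nat) : (r <= d -> (d - r) ^ r <= d ^_ r)%N.
Proof.
suff H j : (j <= r -> (d - r) ^ j <= d ^_ j)%N by move=> _; apply: H.
elim: j => [|j IH] jr; first by rewrite ffactn0.
by rewrite ffactnSr expnSr leq_mul ?IH; lia.
Qed.

(** * Tangent and quadratic bounds for powers *)

Section RealInequalities.
Variable R : realFieldType.
Implicit Types t K mu : R.

Lemma eq_ler (x y : R) : x = y -> x <= y.
Proof. by move->. Qed.

Lemma exp_tangent (t : R) (r : nat) : 0 <= t -> 1 + r%:R * (t - 1) <= t ^+ r.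
Proof.
move=> t0; elim: r => [|r IH]; first by rewrite expr0; lra.
rewrite exprS; have := ler_wpM2l t0 IH.
have r0 : 0 <= r%:R :> R by exact: ler0n.
have: 0 <= r%:R * (t - 1) ^+ 2 by rewrite mulr_ge0 // sqr_ge0.
rewrite -[in r.+1%:R]addn1 natrD; nra.
Qed.

Lemma exp_tangent_at (t mu : R) (r : nat) : 0 <= t -> 0 <= mu ->
  mu ^+ r.+1 + r.+1%:R * mu ^+ r * (t - mu) <= t ^+ r.+1.
Proof.
move=> t0; rewrite le0r => /predU1P[->|mu0].
  rewrite !exprS !mul0r; case: r => [|r]; first by rewrite !expr0; lra.
  by rewrite exprS !mul0r mulr0 mul0r addr0 mulr_ge0 // exprn_ge0.
have tm : 0 <= t / mu by rewrite divr_ge0 // ltW.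
have := ler_wpM2l (ltW (exprn_gt0 r.+1 mu0)) (exp_tangent r.+1 tm).
rewrite -exprMn [mu * (t / mu)]mulrC divfK ?gt_eqF //.
apply: le_trans; apply: eq_ler; by rewrite !exprS; field; rewrite gt_eqF.
Qed.

(** For r+1 <= d the falling factorial is at least (d-r-1)^{r+1}, which lies above its tangent at
    [mu]. For smaller [d] it vanishes, but then the left side is nonpositive. *)
Lemma ffact_tangent (d r : nat) (mu : R) : 0 <= mu ->
  mu ^+ r.+1 + r.+1%:R * mu ^+ r * (d%:R - r.+1%:R - mu) <= (d ^_ r.+1)%:R.
Proof.
move=> mu0; case: (leqP r.+1 d) => rd.
  apply: (@le_trans _ _ ((d - r.+1) ^ r.+1)%:R); last first.
    by rewrite ler_nat leq_exp_sub_ffact.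
  by rewrite natrX -natrB //; apply: exp_tangent_at.
rewrite ffact_small // exprS.
have m0 : 0 <= mu ^+ r by rewrite exprn_ge0.
have -> : mu * mu ^+ r + r.+1%:R * mu ^+ r * (d%:R - r.+1%:R - mu)
  = - (mu ^+ r * (mu * r%:R + r.+1%:R * (r.+1%:R - d%:R))).
  by rewrite -[in LHS]addn1 -[in RHS]addn1 !natrD; ring.
rewrite oppr_le0 mulr_ge0 // addr_ge0 // mulr_ge0 //.
by rewrite subr_ge0 ler_nat ltnW.
Qed.

(** Both sides have the same value and slope at t = 1. The first-order term is written with t^2 - 1
    so that t^2 gets a nonnegative coefficient and t a nonpositive one: summed over codegrees, this
    calls for an upper bound on squares and a lower bound on the plain sum. *)
Lemma exp_le_quadratic (K : R) (r : nat) : 0 <= K -> exists2 L : R, 0 <= L &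
  forall t, 0 <= t <= K ->
    t ^+ r <= 1 + r%:R / 2 * (t ^+ 2 - 1) + L * (t - 1) ^+ 2.
Proof.
move=> K0.
suff [L L0 HL] : exists2 L : R, 0 <= L & forall t, 0 <= t <= K ->
    t ^+ r <= 1 + r%:R * (t - 1) + L * (t - 1) ^+ 2.
  exists L => // t tK; have := HL t tK.
  have: 0 <= r%:R * (t - 1) ^+ 2 by rewrite mulr_ge0 // sqr_ge0.
  nra.
elim: r => [|r [L L0 IH]].
  by exists 0 => // t _; rewrite expr0; lra.
exists (r%:R + L * K) => [|t tK]; first by rewrite addr_ge0 // mulr_ge0.
have [t0 tK'] := andP tK.
rewrite exprS; have := ler_wpM2l t0 (IH t tK).
have: 0 <= L * (K - t) * (t - 1) ^+ 2.
  by rewrite mulr_ge0 ?sqr_ge0 // mulr_ge0 // subr_ge0.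
rewrite -[in r.+1%:R]addn1 natrD; nra.
Qed.

End RealInequalities.

(** * Double counting: moments of common neighbourhoods through degrees and codegrees *)

Section Moments.
Variables (V : finType) (k : nat) (G : {set {set V}}).

(** Its cardinality is the degree of [x] for [Z = [set x]] and the codegree of [x] and [y], through
    a common (k-1)-set, for [Z = [set x; y]]. *)
Definition link (Z : {set V}) : {set {set V}} :=
  [set S : {set V} | (#|S| == k.-1) && (Z \subset nbhd G S)].

Lemma subset_common_nbhd (F : {set {set V}}) (Z : {set V}) :
  (Z \subset common_nbhd G F) = [forall S in F, Z \subset nbhd G S].
Proof. by apply/bigcapsP/forall_inP. Qed.

Lemma card_families (r : nat) : #|families V k r| = 'C('C(#|V|, k.-1), r).
Proof.
rewrite -[X in 'C(X, r)](card_draws V k.-1) -cards_draws; apply: eq_card => F.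
rewrite !inE andbC; congr (_ && _).
by apply/forall_inP/subsetP => h S /h; rewrite inE.
Qed.

Lemma card_families_link (r : nat) (Z : {set V}) :
  #|[set F in families V k r | Z \subset common_nbhd G F]| = 'C(#|link Z|, r).
Proof.
rewrite -cards_draws; apply: eq_card => F.
rewrite !inE subset_common_nbhd -andbA andbC; congr (_ && _).
apply/andP/subsetP => [[/forall_inP h1 /forall_inP h2] S SF|h].
  by rewrite inE h1 // h2.
by split; apply/forall_inP => S /h; rewrite inE => /andP[].
Qed.

(** Both sides count pairs of a vertex [x] and an [r]-family of (k-1)-sets all completed to edges by
    [x]. *)
Lemma sum_common_nbhd (r : nat) :
  (\sum_(F in families V k r) #|common_nbhd G F|
   = \sum_(x : V) 'C(#|link [set x]|, r))%N.
Proof.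
under eq_bigr do rewrite -sum1_card big_mkcond.
rewrite exchange_big; apply: eq_bigr => x _.
rewrite -card_families_link -sum1_card [RHS]big_mkcond [LHS]big_mkcond.
apply: eq_bigr => F _; rewrite inE sub1set.
by do 2 case: (_ \in _).
Qed.

Lemma sum_common_nbhd_sqr (r : nat) :
  (\sum_(F in families V k r) #|common_nbhd G F| ^ 2
   = \sum_(x : V) \sum_(y : V) 'C(#|link [set x; y]|, r))%N.
Proof.
have E (A : {set V}) : (#|A| ^ 2 = \sum_x \sum_y ([set x; y] \subset A))%N.
  rewrite -mulnn -!sum1_card big_distrl /= big_mkcond; apply: eq_bigr => x _.
  case: ifP => xA; last by rewrite big1 // => y _; rewrite subUset sub1set xA.
  rewrite mul1n big_mkcond; apply: eq_bigr => y _.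
  by rewrite subUset !sub1set xA /=; case: (_ \in _).
under eq_bigr do rewrite E.
rewrite exchange_big; apply: eq_bigr => x _.
rewrite exchange_big; apply: eq_bigr => y _.
rewrite -card_families_link -sum1_card [RHS]big_mkcond [LHS]big_mkcond.
apply: eq_bigr => F _; rewrite inE.
by case: (_ \in _); case: (_ \subset _).
Qed.

Hypothesis k2 : (2 <= k)%N.
Hypothesis Gk : uniform k G.

Lemma nbhd_notin (S : {set V}) x : #|S| = k.-1 -> x \in nbhd G S -> x \notin S.
Proof.
rewrite inE => Sk /Gk; rewrite setUC cardsU1 Sk; case: (x \in S) => //=; lia.
Qed.

Lemma sum_link1 : (\sum_(x : V) #|link [set x]| = k * #|G|)%N.
Proof.
transitivity (\sum_(e in G) \sum_(x : V) (x \in e))%N; last first.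
  rewrite mulnC -sum_nat_const; apply: eq_bigr => e eG.
  by rewrite -(Gk eG) -sum1_card [RHS]big_mkcond; apply: eq_bigr => x _; case: ifP.
rewrite exchange_big; apply: eq_bigr => x _.
have -> : (\sum_(e in G) (x \in e) = #|[set e in G | x \in e]|)%N.
  rewrite -sum1_card [RHS]big_mkcond [LHS]big_mkcond; apply: eq_bigr => e _.
  by rewrite inE; case: (_ \in G); case: (x \in e).
have inj : {in link [set x] &, injective (fun S : {set V} => x |: S)}.
  move=> S S'; rewrite !inE !sub1set => /andP[/eqP Sk xS] /andP[/eqP Sk' xS'] E.
  by rewrite -(setU1K (nbhd_notin Sk xS)) -(setU1K (nbhd_notin Sk' xS')) E.
rewrite -(card_in_imset inj); apply: eq_card => e; rewrite inE.
apply/imsetP/andP => [[S]|[eG xe]].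
  rewrite inE sub1set inE setUC => /andP[_ h] ->.
  by split; last exact: setU11.
exists (e :\ x); last by rewrite setD1K.
rewrite inE sub1set inE setUC setD1K // eG andbT.
by move: (Gk eG); rewrite (cardsD1 x) xe => <-; rewrite add1n.
Qed.

(** Each S in the link splits as y and a (k-2)-set S'. For fixed S', the point y lies in the common
    neighbourhood of the sets x |: S' with x in Z, so a bound of BDD type applies. *)
Lemma card_link_le (Z : {set V}) (b : nat) :
  (forall S' : {set V}, #|S'| = k.-2 -> [disjoint S' & Z] ->
     #|common_nbhd G [set x |: S' | x in Z]| <= b)%N ->
  Z != set0 ->
  (#|link Z| <= 'C(#|V|, k.-2) * b)%N.
Proof.
move=> hb /set0Pn[z zZ].
pose A : {set {set V}} := [set S' : {set V} | #|S'| == k.-2].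
(* The hypothesis is silent on S' meeting Z; no S in the link produces such an S', so they are given
   the empty set. *)
pose N (S' : {set V}) := if [disjoint S' & Z] then
  common_nbhd G [set x |: S' | x in Z] else set0.
apply: (@leq_trans #|\bigcup_(S' in A) [set y |: S' | y in N S']|).
  apply: subset_leq_card; apply/subsetP => S; rewrite inE => /andP[/eqP Sk ZS].
  have /card_gt0P[y yS] : (0 < #|S|)%N by rewrite Sk; lia.
  have SZ : [disjoint S & Z].
    rewrite disjoint_sym disjoints_subset; apply/subsetP => x xZ.
    by rewrite inE (nbhd_notin Sk) // (subsetP ZS).
  apply/bigcupP; exists (S :\ y).
    by rewrite inE; move: Sk; rewrite (cardsD1 y) yS; lia.
  apply/imsetP; exists y; last by rewrite setD1K.
  rewrite /N (disjointWl _ SZ) ?subD1set //.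
  apply/bigcapP => _ /imsetP[x xZ ->]; rewrite inE.
  rewrite setUAC -setUA setD1K //.
  by have := subsetP ZS x xZ; rewrite inE setUC.
have -> : 'C(#|V|, k.-2) = #|A| by rewrite card_draws.
rewrite -sum_nat_const.
elim/big_rec2: _ => [|S' u U SA]; first by rewrite cards0.
move=> hU; apply: leq_trans (leq_card_setU _ _) _; rewrite leq_add //.
apply: leq_trans (leq_imset_card _ _) _; rewrite /N.
case: ifP => d; last by rewrite cards0.
by apply: hb => //; move: SA; rewrite inE => /eqP.
Qed.

End Moments.

(** * From pairs to [r]-tuples: the second moment argument *)

Definition atypical (R : realType) (V : finType) (k : nat) (G : {set {set V}})
    (r : nat) (eps p : R) : {set {set {set V}}} :=
  [set F in families V k r |
    ~~ (`| #|common_nbhd G F|%:R - #|V|%:R * p ^+ r |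
          < eps * #|V|%:R * p ^+ r)].

(* The single parameter eta bounds delta, 1 / n and 1 / (n p^D) at once. *)
Definition admissible (R : realType) (k D : nat) (C eta p : R) (V : finType)
    (G : {set {set V}}) : Prop :=
  [/\ uniform k G, pseudorandom k G D C 2 eta p, 0 <= p <= 1,
      1 <= eta * #|V|%:R & 1 <= eta * (#|V|%:R * p ^+ D)].

Section Admissible.
Variables (R : realType) (k D : nat) (C p : R) (V : finType).
Variable G : {set {set V}}.
Local Notation n := (#|V|%:R : R).
Local Notation N := ('C(#|V|, k.-1)%:R : R).

Lemma admissible_le (eta eta' : R) : eta <= eta' ->
  admissible k D C eta p G -> admissible k D C eta' p G.
Proof.
move=> le [Gk [hE hB hT] p01 hn hD]; have /andP[p0 _] := p01.
have nn : 0 <= n by exact: ler0n.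
split=> //; last 2 first.
- by apply: le_trans hn _; rewrite ler_wpM2r.
- by apply: le_trans hD _; rewrite ler_wpM2r // mulr_ge0 // exprn_ge0.
split=> // r r12; apply: le_trans (le_trans (hT r r12) _); last first.
  by rewrite ler_wpM2r.
rewrite ler_nat subset_leq_card //; apply/subsetP => F; rewrite !inE.
move=> /andP[-> /=]; apply: contra => /lt_le_trans; apply.
by rewrite ler_wpM2r ?exprn_ge0 // ler_wpM2r.
Qed.

Variable eta : R.
Hypotheses (hC : 1 < C) (adm : admissible k D C eta p G).

Lemma C_ge0 : 0 <= C.
Proof. exact: le_trans ler01 (ltW hC). Qed.

Lemma admissible_eta_gt0 : 0 < eta.
Proof.
have [_ _ _ hn _] := adm; rewrite ltNge; apply/negP => e0.
have : eta * n <= 0 by rewrite mulr_le0_ge0.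
lra.
Qed.

Lemma admissible_exp (r : nat) : (r <= D)%N -> 1 <= eta * (n * p ^+ r).
Proof.
have [_ _ /andP[p0 p1] _ hD] := adm => rD; apply: le_trans hD _.
rewrite ler_pM2l ?admissible_eta_gt0 // ler_wpM2l //.
exact: ler_wiXn2l.
Qed.

Lemma admissible_BDD (r : nat) (F : {set {set V}}) : (r <= D)%N ->
  F \in families V k r -> #|common_nbhd G F|%:R <= C * n * p ^+ r.
Proof.
have [_ [_ hB _] _ _ _] := adm => rD FF.
(* BDD starts at r = 1; for r = 0 the common neighbourhood is all of V, and C > 1 suffices. *)
case: r rD FF => [_ _|r rD]; last exact: hB.
rewrite expr0 mulr1; apply: le_trans (_ : n <= _); first by rewrite ler_nat max_card.
by rewrite ler_peMl // ltW.
Qed.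

Lemma admissible_p_gt0 : (0 < D)%N -> 0 < p.
Proof.
move=> D0; have [_ _ /andP[p0 _] _ hD] := adm.
rewrite lt_neqAle p0 andbT eq_sym; apply/eqP => pz; move: hD.
by rewrite pz expr0n gtn_eqF //= !mulr0 ler10.
Qed.

Hypothesis k2 : (2 <= k)%N.
Hypothesis kn : (2 * k <= #|V|)%N.

Lemma leq_card_bin : n <= N.
Proof. by rewrite ler_nat leq_bin_self //; lia. Qed.

Lemma bin_pred_le : 'C(#|V|, k.-2)%:R * n <= 2 * k%:R * N.
Proof.
rewrite -!natrM ler_nat.
have := mul_bin_left #|V| k.-2; have -> : k.-2.+1 = k.-1 by lia.
move: ('C(_, k.-2)) ('C(_, k.-1)) => a b E.
have : (a * #|V| <= 2 * ((#|V| - k.-2) * a))%N.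
  rewrite mulnA mulnC leq_mul2r; apply/orP; right; lia.
rewrite -E; nia.
Qed.

Lemma link_le (Z : {set V}) : (0 < #|Z| <= D)%N ->
  #|link k G Z|%:R <= 2 * k%:R * C * p ^+ #|Z| * N.
Proof.
move=> /andP[Z0 ZD]; have [Gk _ /andP[p0 _] _ _] := adm.
set b := C * n * p ^+ #|Z|.
have b0 : 0 <= b by rewrite !mulr_ge0 ?exprn_ge0 ?C_ge0.
have h : (#|link k G Z| <= 'C(#|V|, k.-2) * Num.truncn b)%N.
  apply: card_link_le => //; last by rewrite -card_gt0.
  move=> S' S'k dS; rewrite truncn_ge_nat //; apply: admissible_BDD => //.
  have out x : x \in Z -> x \notin S'.
    by move=> xZ; apply: contraL xZ => xS; rewrite (disjointFr dS).
  rewrite inE card_in_imset ?eqxx /=; last first.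
    move=> x y xZ yZ E; have := setU11 x S'; rewrite E in_setU1.
    by rewrite (negPf (out x xZ)) orbF => /eqP.
  apply/forall_inP => _ /imsetP[x xZ ->].
  by rewrite cardsU1 out // S'k add1n; apply/eqP; lia.
apply: (@le_trans _ _ ('C(#|V|, k.-2)%:R * b)).
  apply: le_trans (_ : ('C(#|V|, k.-2) * Num.truncn b)%:R <= _); first by rewrite ler_nat.
  by rewrite natrM ler_wpM2l // truncn_le.
have -> : 'C(#|V|, k.-2)%:R * b = C * p ^+ #|Z| * ('C(#|V|, k.-2)%:R * n).
  by rewrite /b; ring.
have -> : 2 * k%:R * C * p ^+ #|Z| * N = C * p ^+ #|Z| * (2 * k%:R * N) by ring.
by rewrite ler_wpM2l ?bin_pred_le // mulr_ge0 ?exprn_ge0 // C_ge0.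
Qed.

Lemma sum_link1_eq : \sum_x #|link k G [set x]|%:R = p * (n - k%:R + 1) * N.
Proof.
have [Gk [hE _ _] _ _ _] := adm.
rewrite -natr_sum sum_link1 // natrM hE mulrCA -mulrA; congr (_ * _).
have := mul_bin_left #|V| k.-1; rewrite prednK; last by lia.
move=> /(congr1 (fun a => a%:R : R)); rewrite !natrM => ->; congr (_ * _).
rewrite natrB; last by lia.
have -> : k%:R = k.-1%:R + 1 :> R by rewrite natr1 prednK //; lia.
by ring.
Qed.

Local Notation codeg x y := (#|link k G [set x; y]|%:R : R).

Lemma sum_codegE :
  \sum_x \sum_y codeg x y
  = \sum_(F in families V k 1) #|common_nbhd G F|%:R ^+ 2.
Proof.
under [RHS]eq_bigr do rewrite -natrX.
rewrite -natr_sum sum_common_nbhd_sqr natr_sum.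
by apply: eq_bigr => x _; rewrite natr_sum; apply: eq_bigr => y _; rewrite bin1.
Qed.

(** Cauchy-Schwarz in linear form: X^2 >= 2 mu X - mu^2 at mu = n p, where the sum of X is known
    exactly from the edge count. *)
Lemma sum_codeg_ge :
  N * n ^+ 2 * p ^+ 2 * (1 - 2 * k%:R * eta) <= \sum_x \sum_y codeg x y.
Proof.
have [Gk _ /andP[p0 _] hn _] := adm.
rewrite sum_codegE.
apply: (@le_trans _ _ (\sum_(F in families V k 1)
   (2 * (n * p) * #|common_nbhd G F|%:R - (n * p) ^+ 2))); last first.
  apply: ler_sum => F _.
  have := sqr_ge0 (#|common_nbhd G F|%:R - n * p); nra.
rewrite sumrB -mulr_sumr -natr_sum sum_common_nbhd sumr_const card_families bin1.
under eq_bigr do rewrite bin1.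
rewrite natr_sum sum_link1_eq -[_ ^+ 2 *+ _]mulr_natl.
have -> : 2 * (n * p) * (p * (n - k%:R + 1) * N) - N * (n * p) ^+ 2
   = N * n * p ^+ 2 * (n - 2 * k%:R + 2) by ring.
have -> : N * n ^+ 2 * p ^+ 2 * (1 - 2 * k%:R * eta) =
   N * n * p ^+ 2 * (n - 2 * k%:R * (eta * n)) by ring.
rewrite ler_wpM2l ?mulr_ge0 ?exprn_ge0 //.
have : 0 <= k%:R * (eta * n - 1) by rewrite mulr_ge0 // subr_ge0.
lra.
Qed.

Hypothesis D2 : (2 <= D)%N.

Lemma one_le_eta_pow (j : nat) : (j <= D)%N -> 1 <= eta * (p ^+ j * N).
Proof.
move=> jD; apply: le_trans (admissible_exp jD) _.
have [_ _ /andP[p0 _] _ _] := adm.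
by rewrite ler_pM2l ?admissible_eta_gt0 // mulrC ler_wpM2l ?exprn_ge0 // leq_card_bin.
Qed.

(** Deliberately crude: this sum is only the lower-order term in a^2 = 2 C(a,2) + a, so a bound with
    an extra factor [eta] is enough. *)
Lemma sum_codeg_le :
  \sum_x \sum_y codeg x y <= N ^+ 2 * n ^+ 2 * p ^+ 4 * (C ^+ 2 * eta).
Proof.
have [Gk _ /andP[p0 _] hn _] := adm.
have C0 := C_ge0.
rewrite sum_codegE.
apply: (@le_trans _ _ (\sum_(F in families V k 1) (C * n * p ^+ 1) ^+ 2)).
  apply: ler_sum => F FF; rewrite lerXn2r ?nnegrE ?mulr_ge0 //.
  by apply: admissible_BDD => //; lia.
rewrite sumr_const card_families bin1 -[_ ^+ 2 *+ _]mulr_natl expr1.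
have -> : N * (C * n * p) ^+ 2 = N * C ^+ 2 * n ^+ 2 * p ^+ 2 * 1 by ring.
have -> : N ^+ 2 * n ^+ 2 * p ^+ 4 * (C ^+ 2 * eta)
  = N * C ^+ 2 * n ^+ 2 * p ^+ 2 * (eta * (p ^+ 2 * N)) by ring.
by rewrite ler_wpM2l ?one_le_eta_pow // !mulr_ge0 ?exprn_ge0.
Qed.

Lemma natr_bin2 (a : nat) : a%:R ^+ 2 = 2 * 'C(a, 2)%:R + a%:R :> R.
Proof.
case: a => [|a]; first by rewrite bin0n !mulr0n expr2 !mulr0 addr0.
have : ('C(a.+1, 2) * 2 = a.+1 * a)%N.
  by rewrite (bin_ffact a.+1 2) !ffactnS ffactn0 muln1.
move=> /(congr1 (fun b => b%:R : R)); rewrite !natrM => E.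
by rewrite -[in RHS](mulrC _ 2) E -!natr1; ring.
Qed.

Hypothesis eta1 : eta <= 1.

(** The binomial part of the squares is the second moment of common neighbourhoods of pairs of
    (k-1)-sets: TUPLE(2) handles typical pairs, BDD the few others. *)
Lemma sum_codeg_sqr_le :
  \sum_x \sum_y codeg x y ^+ 2
    <= N ^+ 2 * n ^+ 2 * p ^+ 4 * (1 + (3 + 2 * C ^+ 2) * eta).
Proof.
have [Gk [_ _ hT] /andP[p0 _] hn _] := adm.
have e0 := admissible_eta_gt0.
under eq_bigr do under eq_bigr do rewrite natr_bin2.
under eq_bigr do rewrite big_split -mulr_sumr.
rewrite big_split /= -mulr_sumr.
have -> : \sum_x \sum_y 'C(#|link k G [set x; y]|, 2)%:R
   = \sum_(F in families V k 2) #|common_nbhd G F|%:R ^+ 2 :> R.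
  under [RHS]eq_bigr do rewrite -natrX.
  rewrite -natr_sum sum_common_nbhd_sqr natr_sum.
  by apply: eq_bigr => x _; rewrite natr_sum.
have h2 : \sum_(F in families V k 2) #|common_nbhd G F|%:R ^+ 2 <=
   'C('C(#|V|, k.-1), 2)%:R * (n ^+ 2 * p ^+ 4 * ((1 + eta) ^+ 2 + C ^+ 2 * eta)).
  apply: (@le_trans _ _ (\sum_(F in families V k 2) (((1 + eta) * n * p ^+ 2) ^+ 2
     + if F \in atypical k G 2 eta p then (C * n * p ^+ 2) ^+ 2 else 0))).
    apply: ler_sum => F FF; rewrite [F \in atypical _ _ _ _ _]inE FF /=.
    case: ifPn => [_|].
      apply: ler_wpDl; first exact: sqr_ge0.
      rewrite lerXn2r ?nnegrE // ?mulr_ge0 ?exprn_ge0 ?C_ge0 //.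
      exact: admissible_BDD.
    rewrite negbK addr0 => /ltW; rewrite ler_norml => /andP[_ h].
    rewrite lerXn2r ?nnegrE // ?mulr_ge0 ?exprn_ge0 //; last lra.
    by lra.
  rewrite big_split /= sumr_const card_families -big_mkcondr /= sumr_const.
  have -> : #|[pred F in families V k 2 | F \in atypical k G 2 eta p]|
      = #|atypical k G 2 eta p|.
    by apply: eq_card => F; rewrite !inE andbA andbb.
  have /= := hT 2 isT; rewrite -/(atypical k G 2 eta p) => hb.
  rewrite -![_ ^+ 2 *+ _]mulr_natl.
  have := ler_wpM2r (sqr_ge0 (C * n * p ^+ 2)) hb; nra.
have := sum_codeg_le; move: (\sum_x _) => s1 hs1.
have hN2 : 2 * 'C('C(#|V|, k.-1), 2)%:R <= N ^+ 2.
  by rewrite natr_bin2 lerDl.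
set A := n ^+ 2 * p ^+ 4 in h2.
have A0 : 0 <= A by rewrite mulr_ge0 ?exprn_ge0.
have -> : N ^+ 2 * n ^+ 2 * p ^+ 4 * (1 + (3 + 2 * C ^+ 2) * eta)
   = N ^+ 2 * (A * (1 + (3 + 2 * C ^+ 2) * eta)) by rewrite /A; ring.
have hs1' : s1 <= N ^+ 2 * (A * (C ^+ 2 * eta)).
  by rewrite (_ : N ^+ 2 * _ = N ^+ 2 * n ^+ 2 * p ^+ 4 * (C ^+ 2 * eta)) // /A; ring.
set B := A * ((1 + eta) ^+ 2 + C ^+ 2 * eta) in h2.
have B0 : 0 <= B by rewrite mulr_ge0 // addr_ge0 ?sqr_ge0 // mulr_ge0 ?sqr_ge0 // ltW.
have h3 := ler_wpM2r B0 hN2.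
have h4 : B + A * (C ^+ 2 * eta) <= A * (1 + (3 + 2 * C ^+ 2) * eta).
  rewrite -mulrDr ler_wpM2l //.
  have : 0 <= eta * (1 - eta) by rewrite mulr_ge0 ?subr_ge0 // ltW.
  nra.
have := ler_wpM2l (sqr_ge0 N) h4; rewrite mulrDr.
lra.
Qed.

Variable r : nat.
Hypothesis rD : (r.+1 <= D)%N.
Local Notation K := (2 * k%:R * C).
Local Notation a := (r.+1%:R / 2 : R).

(** The tangent at p N leaves only the exact degree sum to evaluate. The losses from n - k + 1 and
    from the falling factorial are absorbed by 1 <= eta n and 1 <= eta p N. *)
Lemma sum_link1_ffact_ge :
  n * (p * N) ^+ r.+1 * (1 - (r.+1%:R ^+ 2 + r.+1%:R * k%:R) * eta)
    <= \sum_x (#|link k G [set x]| ^_ r.+1)%:R.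
Proof.
have [Gk _ /andP[p0 _] hn _] := adm.
have e0 := admissible_eta_gt0.
set mu := p * N; have mu0 : 0 <= mu by rewrite mulr_ge0.
apply: (@le_trans _ _ (\sum_(x : V) (mu ^+ r.+1 + r.+1%:R * mu ^+ r *
   (#|link k G [set x]|%:R - r.+1%:R - mu)))); last first.
  by apply: ler_sum => x _; apply: ffact_tangent.
rewrite big_split /= -mulr_sumr !sumrB sum_link1_eq !sumr_const.
rewrite -[_ ^+ _ *+ _]mulr_natl -[r.+1%:R *+ _]mulr_natl -[mu *+ _]mulr_natl.
have e1 : 1 <= eta * mu.
  by have := one_le_eta_pow (ltnW D2); rewrite expr1.
have M0 : 0 <= mu ^+ r by rewrite exprn_ge0.
have -> : p * (n - k%:R + 1) * N - n * r.+1%:R - n * mu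
  = - ((k%:R - 1) * mu + n * r.+1%:R) by rewrite /mu; ring.
rewrite exprS.
have h1 : 0 <= r.+1%:R * mu ^+ r * (n * r.+1%:R) * (eta * mu - 1).
  by rewrite !mulr_ge0 ?subr_ge0.
have h2 : 0 <= r.+1%:R * mu ^+ r * k%:R * mu * (eta * n - 1).
  by rewrite !mulr_ge0 ?subr_ge0.
have h3 : 0 <= r.+1%:R * mu ^+ r * mu by rewrite !mulr_ge0.
nra.
Qed.

Lemma sum_codeg_exp_le (L : R) : 0 <= L ->
  (forall t, 0 <= t <= K ->
     t ^+ r.+1 <= 1 + a * (t ^+ 2 - 1) + L * (t - 1) ^+ 2) ->
  \sum_x \sum_y codeg x y ^+ r.+1 <= (p ^+ 2 * N) ^+ r.+1 * (n ^+ 2 *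
    (1 + (a * (3 + 2 * C ^+ 2) + L * (3 + 2 * C ^+ 2 + 4 * k%:R)
          + K ^+ r.+1 + a) * eta)).
Proof.
move=> L0 hL.
have [Gk _ /andP[p0 _] hn _] := adm.
have e0 := admissible_eta_gt0; have C0 := C_ge0.
have pp : 0 < p by apply: admissible_p_gt0; lia.
have n0 : 0 < n by rewrite ltr0n; lia.
have N0 : 0 < N := lt_le_trans n0 leq_card_bin.
set q := p ^+ 2 * N; have q0 : 0 < q by rewrite mulr_gt0 // exprn_gt0.
have qn0 : q != 0 by rewrite gt_eqF.
pose t x y := codeg x y / q.
have t0 x y : 0 <= t x y by rewrite divr_ge0 // ltW.
have K0 : 0 <= K by rewrite !mulr_ge0.
have a0 : 0 <= a by rewrite divr_ge0.
(* Allowance for the diagonal: [codeg x x] is a degree, so t x x is bounded by K / p rather than K,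
   and the quadratic is at least 1 - a. Only n such terms occur, and eta n p^{r+1} >= 1 makes them
   negligible. *)
set E := (K / p) ^+ r.+1 + a.
have ht x y : t x y ^+ r.+1 <= (1 - a + L) + (a + L) * t x y ^+ 2
    - 2 * L * t x y + (if y == x then E else 0).
  case: eqP => [->|/eqP xy].
    have h : t x x ^+ r.+1 <= (K / p) ^+ r.+1.
      rewrite lerXn2r ?nnegrE ?divr_ge0 ?(ltW q0) // /t ler_pdivrMr //.
      rewrite setUid; have := @link_le [set x]; rewrite cards1.
      move=> /(_ (ltnW D2)) /le_trans; apply.
      rewrite /q expr1; apply: eq_ler; field.
      by rewrite gt_eqF.
    rewrite /E; have := sqr_ge0 (t x x); have := sqr_ge0 (t x x - 1) => u1 u2.
    have := mulr_ge0 L0 u1; have := mulr_ge0 a0 u2; nra.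
  have := hL (t x y); rewrite t0 /=.
  have -> : t x y <= K.
    rewrite /t ler_pdivrMr //; have := @link_le [set x; y].
    rewrite cards2 eq_sym xy /= => /(_ D2) /le_trans; apply.
    by apply: eq_ler; rewrite /q; ring.
  move=> /(_ isT) /le_trans; apply; rewrite addr0.
  by apply: eq_ler; ring.
have -> : \sum_x \sum_y codeg x y ^+ r.+1
   = q ^+ r.+1 * \sum_x \sum_y t x y ^+ r.+1.
  rewrite mulr_sumr; apply: eq_bigr => x _; rewrite mulr_sumr.
  by apply: eq_bigr => y _; rewrite -exprMn /t [q * _]mulrC divfK.
rewrite ler_wpM2l ?exprn_ge0 ?(ltW q0) //.
apply: le_trans (ler_sum _ (fun x _ => ler_sum _ (fun y _ => ht x y))) _.
have s1E : \sum_x \sum_y codeg x y = q * \sum_x \sum_y t x y.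
  rewrite mulr_sumr; apply: eq_bigr => x _; rewrite mulr_sumr.
  by apply: eq_bigr => y _; rewrite /t [q * _]mulrC divfK.
have s2E : \sum_x \sum_y codeg x y ^+ 2 = q ^+ 2 * \sum_x \sum_y t x y ^+ 2.
  rewrite mulr_sumr; apply: eq_bigr => x _; rewrite mulr_sumr.
  by apply: eq_bigr => y _; rewrite -exprMn /t [q * _]mulrC divfK.
have s1 : n ^+ 2 * (1 - 2 * k%:R * eta) <= \sum_x \sum_y t x y.
  rewrite -(ler_pM2l q0) -s1E; apply: le_trans sum_codeg_ge.
  by apply: eq_ler; rewrite /q; ring.
have s2 : \sum_x \sum_y t x y ^+ 2 <= n ^+ 2 * (1 + (3 + 2 * C ^+ 2) * eta).
  rewrite -(ler_pM2l (exprn_gt0 2 q0)) -s2E; apply: le_trans sum_codeg_sqr_le _.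
  by apply: eq_ler; rewrite /q; ring.
have -> : \sum_x \sum_y ((1 - a + L) + (a + L) * t x y ^+ 2
    - 2 * L * t x y + (if y == x then E else 0))
  = n ^+ 2 * (1 - a + L) + (a + L) * (\sum_x \sum_y t x y ^+ 2)
    - 2 * L * (\sum_x \sum_y t x y) + n * E.
  transitivity (\sum_(x : V) (n * (1 - a + L) + (a + L) * (\sum_y t x y ^+ 2)
    - 2 * L * (\sum_y t x y) + E)).
    apply: eq_bigr => x _; rewrite big_split sumrB big_split /= sumr_const.
    by rewrite -!mulr_sumr -big_mkcond big_pred1_eq -[_ *+ #|_|]mulr_natl.
  rewrite big_split sumrB big_split /= !sumr_const -!mulr_sumr.
  by rewrite -[_ * _ *+ #|_|]mulr_natl -[E *+ #|_|]mulr_natl mulrA expr2.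
have hE : n * E <= n ^+ 2 * ((K ^+ r.+1 + a) * eta).
  have -> : n ^+ 2 * ((K ^+ r.+1 + a) * eta) = n * ((K ^+ r.+1 + a) * (eta * n)).
    by ring.
  rewrite /E ler_wpM2l //.
  have P0 : 0 < p ^+ r.+1 by rewrite exprn_gt0.
  have h1 : (K / p) ^+ r.+1 <= K ^+ r.+1 * (eta * n).
    rewrite expr_div_n ler_pdivrMr // -[leRHS]mulrA.
    rewrite ler_peMr ?exprn_ge0 // -mulrA.
    exact: admissible_exp.
  have h2 := ler_wpM2l a0 hn; lra.
have h1 := ler_wpM2l (addr_ge0 a0 L0) s2.
have h2 := ler_wpM2l L0 s1.
lra.
Qed.

(** Chebyshev around mu = n p^{r+1}. After multiplication by (r+1)!, the three parts of the variance
    have main terms 1 - 2 + 1 times mu^2 N^{r+1}, so only terms of order [eta] survive. *)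
Lemma card_atypical_le (L eps : R) : 0 <= L -> 0 < eps ->
  (forall t, 0 <= t <= K ->
     t ^+ r.+1 <= 1 + a * (t ^+ 2 - 1) + L * (t - 1) ^+ 2) ->
  #|atypical k G r.+1 eps p|%:R * eps ^+ 2 <= N ^+ r.+1 *
    ((a * (3 + 2 * C ^+ 2) + L * (3 + 2 * C ^+ 2 + 4 * k%:R) + K ^+ r.+1 + a
      + 2 * (r.+1%:R ^+ 2 + r.+1%:R * k%:R)) * eta).
Proof.
move=> L0 eps0 hL.
have [Gk _ /andP[p0 _] hn _] := adm.
have e0 := admissible_eta_gt0; have C0 := C_ge0.
have pp : 0 < p by apply: admissible_p_gt0; lia.
have n0 : 0 < n by rewrite ltr0n; lia.
have := sum_codeg_exp_le L0 hL; have := sum_link1_ffact_ge.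
set c4 := _ + _ * k%:R; set c3 := _ + a => h1 h2.
set X := fun F : {set {set V}} => #|common_nbhd G F|%:R : R.
set mu := n * p ^+ r.+1; have mu0 : 0 < mu by rewrite mulr_gt0 // exprn_gt0.
set f : R := (r.+1)`!%:R; have f1 : 1 <= f by rewrite ler1n fact_gt0.
have f0 : 0 <= f by lra.
have m1 : f * \sum_(F in families V k r.+1) X F
    = \sum_x (#|link k G [set x]| ^_ r.+1)%:R.
  rewrite -natr_sum sum_common_nbhd natr_sum mulr_sumr; apply: eq_bigr => x _.
  by rewrite -bin_ffact natrM mulrC.
have m2 : f * \sum_(F in families V k r.+1) X F ^+ 2
    <= \sum_x \sum_y codeg x y ^+ r.+1.
  rewrite /X; under eq_bigr do rewrite -natrX.
  rewrite -natr_sum sum_common_nbhd_sqr natr_sum mulr_sumr; apply: ler_sum => x _.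
  rewrite natr_sum mulr_sumr; apply: ler_sum => y _.
  by rewrite mulrC -natrM bin_ffact -natrX ler_nat leq_ffact_exp.
have m0 : f * #|families V k r.+1|%:R <= N ^+ r.+1.
  by rewrite card_families mulrC -natrM bin_ffact -natrX ler_nat leq_ffact_exp.
have cheb : #|atypical k G r.+1 eps p|%:R * (eps * mu) ^+ 2
    <= \sum_(F in families V k r.+1) (X F - mu) ^+ 2.
  rewrite [leRHS](bigID (mem (atypical k G r.+1 eps p))) /=.
  apply: ler_wpDr; first by apply: sumr_ge0 => F _; exact: sqr_ge0.
  have -> : \sum_(F in families V k r.+1 | F \in atypical k G r.+1 eps p)
     (X F - mu) ^+ 2 = \sum_(F in atypical k G r.+1 eps p) (X F - mu) ^+ 2.
    by apply: eq_bigl => F; rewrite !inE andbA andbb.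
  rewrite mulr_natl -sumr_const; apply: ler_sum => F.
  rewrite inE -leNgt -mulrA => /andP[_ hF].
  rewrite -(real_normK (num_real (X F - mu))).
  have em0 : 0 <= eps * mu := mulr_ge0 (ltW eps0) (ltW mu0).
  by apply: lerXn2r; rewrite ?nnegrE.
have ex : \sum_(F in families V k r.+1) (X F - mu) ^+ 2 =
  \sum_(F in families V k r.+1) X F ^+ 2
  - 2 * mu * \sum_(F in families V k r.+1) X F
  + #|families V k r.+1|%:R * mu ^+ 2.
  rewrite (eq_bigr (fun F => X F ^+ 2 - 2 * mu * X F + mu ^+ 2)); last first.
    by move=> F _; ring.
  by rewrite big_split sumrB -mulr_sumr /= sumr_const -[_ *+ #|_|]mulr_natl.
have P4 : (p ^+ 2 * N) ^+ r.+1 = p ^+ r.+1 ^+ 2 * N ^+ r.+1.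
  by rewrite exprMn exprAC.
have tot : f * \sum_(F in families V k r.+1) (X F - mu) ^+ 2
   <= mu ^+ 2 * (N ^+ r.+1 * ((c3 + 2 * c4) * eta)).
  rewrite ex.
  have k0 := ler_wpM2r (sqr_ge0 mu) m0.
  rewrite -m1 in h1.
  have k1 := ler_wpM2l (ltW mu0) h1.
  have {h2} := le_trans m2 h2; rewrite P4 => k2q.
  move: k1; rewrite exprMn => k1.
  have E1 : mu * (n * (p ^+ r.+1 * N ^+ r.+1) * (1 - c4 * eta))
     = mu ^+ 2 * N ^+ r.+1 * (1 - c4 * eta) by rewrite /mu; ring.
  have E2 : p ^+ r.+1 ^+ 2 * N ^+ r.+1 * (n ^+ 2 * (1 + c3 * eta))
     = mu ^+ 2 * N ^+ r.+1 * (1 + c3 * eta) by rewrite /mu; ring.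
  rewrite E1 in k1; rewrite E2 in k2q.
  nra.
have S0 : 0 <= \sum_(F in families V k r.+1) (X F - mu) ^+ 2.
  by apply: sumr_ge0 => F _; exact: sqr_ge0.
rewrite -(ler_pM2l (exprn_gt0 2 mu0)).
apply: le_trans tot; rewrite mulrCA -exprMn [mu * eps]mulrC.
apply: le_trans cheb _.
by rewrite ler_peMl.
Qed.

End Admissible.

Lemma atypical_rare (R : realType) (k D r : nat) (C eps : R) :
  (2 <= k)%N -> 1 < C -> (r <= D)%N -> 0 < eps ->
  exists2 eta : R, 0 < eta &
  forall (V : finType) (G : {set {set V}}) (p : R),
    admissible k D C eta p G ->
    #|atypical k G r eps p|%:R <= eps * #|V|%:R ^+ (k.-1 * r).
Proof.
move=> k2 hC; case: r => [|[|r]] rD eps0.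
- exists 1 => // V G p [_ _ _ hn _].
  suff -> : atypical k G 0 eps p = set0 by rewrite cards0 mulr_ge0 // ?exprn_ge0 // ltW.
  apply/setP => F; rewrite !inE; apply/negP => /andP[/andP[/eqP/cards0_eq -> _]].
  rewrite /common_nbhd big_set0 cardsT expr0 !mulr1 subrr normr0 mulr_gt0 //.
  by move: hn; rewrite mul1r; apply: lt_le_trans.
- exists eps => // V G p [_ [_ _ hT] /andP[p0 _] _ _].
  apply: le_trans (hT 1%N isT) _.
  by rewrite bin1 muln1 -natrX ler_pM2l // ler_nat leq_bin_exp.
have K0 : 0 <= 2 * k%:R * C by rewrite !mulr_ge0 // (le_trans ler01) // ltW.
have [L L0 hL] := exp_le_quadratic r.+2 K0.
set c : R := r.+2%:R / 2 * (3 + 2 * C ^+ 2) + L * (3 + 2 * C ^+ 2 + 4 * k%:R)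
  + (2 * k%:R * C) ^+ r.+2 + r.+2%:R / 2 + 2 * (r.+2%:R ^+ 2 + r.+2%:R * k%:R).
have c0 : 0 <= c.
  have C0 := sqr_ge0 C; have := exprn_ge0 r.+2 K0.
  have k0 : 0 <= k%:R :> R by [].
  have r0 : 0 <= r.+2%:R :> R by [].
  have h1 : 0 <= r.+2%:R / 2 * (3 + 2 * C ^+ 2) by rewrite mulr_ge0 ?divr_ge0 //; lra.
  have h2 : 0 <= L * (3 + 2 * C ^+ 2 + 4 * k%:R) by rewrite mulr_ge0 //; lra.
  have h3 : 0 <= r.+2%:R ^+ 2 + r.+2%:R * k%:R :> R.
    by rewrite addr_ge0 ?sqr_ge0 ?mulr_ge0.
  by rewrite /c; lra.
(* The bound 1/(2k) forces n >= 2k through 1 <= eta n; eps^3 pays for the eps^2 of Chebyshev and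
   leaves eps. *)
pose eta := Num.min 1 (Num.min (2 * k%:R)^-1 (eps ^+ 3 / (c + 1))).
have k0 : 0 < 2 * k%:R :> R by rewrite mulr_gt0 // ltr0n; lia.
have c1 : 0 < c + 1 by lra.
have eta0 : 0 < eta by rewrite !lt_min ltr01 invr_gt0 k0 divr_gt0 // exprn_gt0.
exists eta => // V G p adm.
have [_ _ /andP[p0 _] hn _] := adm.
have e1 : eta <= 1 by rewrite ge_min lexx.
have e2 : eta <= (2 * k%:R)^-1 by rewrite !ge_min lexx !orbT.
have e3 : c * eta <= eps ^+ 3.
  apply: (@le_trans _ _ ((c + 1) * eta)); first by rewrite ler_pM2r //; lra.
  by rewrite mulrC -ler_pdivlMr // !ge_min lexx !orbT.
have kn : (2 * k <= #|V|)%N.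
  rewrite -(ler_nat R) natrM -[leLHS]mulr1 mulrC -ler_pdivlMr // mulrC.
  by apply: le_trans hn _; rewrite ler_wpM2r.
have D2 : (2 <= D)%N by apply: leq_trans rD.
have h := card_atypical_le hC adm k2 kn D2 e1 rD L0 eps0 hL.
rewrite -(ler_pM2r (exprn_gt0 2 eps0)); apply: le_trans h _.
rewrite -/c mulrC exprM; apply: (@le_trans _ _ (eps ^+ 3 * 'C(#|V|, k.-1)%:R ^+ r.+2)).
  by rewrite ler_wpM2r ?exprn_ge0.
rewrite [leRHS]mulrAC -exprS ler_wpM2l ?exprn_ge0 ?(ltW eps0) //.
by apply: lerXn2r; rewrite ?nnegrE ?exprn_ge0 // -natrX ler_nat leq_bin_exp.
Qed.

(** * Changing a map at one vertex *)

Section Update.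
Variables T V : finType.

Definition upd (phi : {ffun T -> V}) (v : T) (x : V) : {ffun T -> V} :=
  [ffun u => if u == v then x else phi u].

(* The map (phi, x) |-> (phi with v sent to x, phi v) is an involution. *)
Lemma sum_upd (F : {ffun T -> V} -> nat) (v : T) :
  (\sum_phi \sum_x F (upd phi v x) = #|V| * \sum_phi F phi)%N.
Proof.
have -> : (#|V| * \sum_phi F phi = \sum_(phi : {ffun T -> V}) \sum_(x : V) F phi)%N.
  by rewrite big_distrr; apply: eq_bigr => phi _; rewrite sum_nat_const.
rewrite !pair_bigA /=.
pose h (q : {ffun T -> V} * V) := (upd q.1 v q.2, q.1 v).
have hK : involutive h.
  case=> phi x; rewrite /h /= ffunE eqxx; congr pair; apply/ffunP => u.
  by rewrite !ffunE; case: eqP => // ->.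
by rewrite [RHS](reindex_inj (inv_inj hK)).
Qed.

Lemma imset_upd_out (phi : {ffun T -> V}) v x (A : {set T}) :
  v \notin A -> upd phi v x @: A = phi @: A.
Proof.
move=> vA; apply: eq_in_imset => u uA; rewrite ffunE.
by case: eqP => // uv; rewrite -uv uA in vA.
Qed.

Lemma imset_upd_in (phi : {ffun T -> V}) v x (A : {set T}) :
  v \in A -> upd phi v x @: A = phi @: (A :\ v) :|: [set x].
Proof.
move=> vA; rewrite -{1}(setD1K vA) imsetU1 ffunE eqxx setUC.
by rewrite imset_upd_out // setD11.
Qed.

Lemma card_ffun_into (N : {set T}) (A : {set V}) :
  #|[set phi : {ffun T -> V} | [forall u in N, phi u \in A]]|
  = (#|A| ^ #|N| * #|V| ^ (#|T| - #|N|))%N.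
Proof.
pose B u : pred V := fun x => (u \in N) ==> (x \in A).
have -> : #|[set phi : {ffun T -> V} | [forall u in N, phi u \in A]]|
   = #|family B|.
  apply: eq_card => phi; rewrite inE; apply/forall_inP/familyP => h u.
    by apply/implyP; apply: h.
  by move=> uN; have := h u; rewrite unfold_in uN.
rewrite card_family foldrE big_map big_enum /=.
rewrite (bigID (mem N)) /=; congr (_ * _)%N.
  rewrite -prod_nat_const; apply: eq_bigr => u uN.
  by apply: eq_card => x; rewrite unfold_in uN.
rewrite -(cardsC N) addKn -prod_nat_const.
apply: eq_big => [u|u uN]; first by rewrite inE.
by apply: eq_card => x; rewrite unfold_in (negPf uN).
Qed.

End Update.

(** * Low-degree orderings, linearity and the absence of connectors *)

Section Structure.
Variables (T : finType) (H : {set {set T}}) (k : nat).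
Implicit Types (W U e : {set T}) (v w : T).

Definition inner W : {set {set T}} := [set e in H | e \subset W].

Definition star W v : {set {set T}} :=
  [set e in H | (e \subset W) && (v \in e)].

Definition punctured W v : {set {set T}} := [set e :\ v | e in star W v].

Lemma card_inner W v : v \in W ->
  #|inner W| = (#|inner (W :\ v)| + #|star W v|)%N.
Proof.
move=> vW; rewrite -(cardsID [set e : {set T} | v \in e] (inner W)) addnC; congr (_ + _)%N.
  by apply: eq_card => e; rewrite !inE subsetD1; case: (_ \in H) => //=; rewrite andbC.
by apply: eq_card => e; rewrite !inE andbA.
Qed.

Lemma star_le_max_deg W v : (#|star W v| <= max_deg H)%N.
Proof.
apply: leq_trans (leq_bigmax v); apply: subset_leq_card; apply/subsetP => e.
by rewrite !inE => /and3P[-> _ ->].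
Qed.

Lemma ex_low_star W : W != set0 -> exists2 v, v \in W & (#|star W v| <= d_H H)%N.
Proof.
case/set0Pn => v0 v0W.
case: (arg_minnP (fun v => #|star W v|) v0W) => v vW vmin; exists v => //.
have sub : subhypergraph H (W, inner W).
  apply/and3P; split => /=; first by apply/set0Pn; exists v0.
    by apply/subsetP => e; rewrite inE => /andP[].
  by apply/forall_inP => e; rewrite inE => /andP[].
have starE u : vdeg (inner W) u = #|star W u|.
  by apply: eq_card => e; rewrite !inE andbA.
apply: (bigop.bigmax_sup (W, inner W) sub); rewrite /min_deg /=.
(* The first case is the default value of [min_deg], the number of all edges inside W, which also
   bounds a star. *)
elim/big_rec: _ => [|u y uW hy].
  apply: subset_leq_card; apply/subsetP => e.
  by rewrite !inE => /and3P[-> ->].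
by rewrite leq_min hy starE vmin.
Qed.

Hypotheses (Hk : uniform k H) (k2 : (2 <= k)%N) (Hlin : linear_hypergraph H).

Lemma linear_eq e f x y : e \in H -> f \in H -> x != y ->
  x \in e -> x \in f -> y \in e -> y \in f -> e = f.
Proof.
move=> eH fH xy xe xf ye yf; apply/eqP; apply: contraT => ef.
have := Hlin eH fH ef; rewrite leqNgt (_ : (1 < _)%N) //.
apply/card_gt1P; exists x, y; split=> //; by rewrite inE ?xe ?ye.
Qed.

Lemma puncture_inj W v : {in star W v &, injective (fun e => e :\ v)}.
Proof.
move=> e f; rewrite !inE => /and3P[_ _ ve] /and3P[_ _ vf] E.
by rewrite -(setD1K ve) -(setD1K vf) E.
Qed.

Lemma cover_puncturedP W v x :
  reflect (exists2 e, e \in star W v & (x != v) && (x \in e))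
          (x \in cover (punctured W v)).
Proof.
apply: (iffP bigcupP) => [[_ /imsetP[e es ->]]|[e es xe]].
  by rewrite !inE => h; exists e.
by exists (e :\ v); [apply: imset_f | rewrite !inE].
Qed.

Lemma card_cover_punctured W v :
  #|cover (punctured W v)| = (k.-1 * #|star W v|)%N.
Proof.
have tI : trivIset (punctured W v).
  apply/trivIsetP => _ _ /imsetP[e es ->] /imsetP[f fs ->] ef.
  rewrite -setI_eq0; apply: contraT => /set0Pn[x].
  rewrite !inE => /andP[/andP[xv xe] /andP[_ xf]].
  move: es fs ef; rewrite !inE => /and3P[eH _ ve] /and3P[fH _ vf].
  by rewrite (linear_eq eH fH xv) // eqxx.
move: (tI); rewrite /trivIset => /eqP <-.
rewrite (eq_bigr (fun=> k.-1)); last first.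
  move=> _ /imsetP[e es ->]; move: es; rewrite !inE => /and3P[/Hk eH _ ve].
  by move: eH; rewrite (cardsD1 v) ve => <-.
by rewrite sum_nat_const mulnC card_in_imset //; apply: puncture_inj.
Qed.

(** Edges at w that meet N are charged to a vertex of N they contain; by linearity each such vertex
    shares at most one edge with w. *)
Lemma star_le_link U w (N : {set T}) : w \notin N ->
  (#|star U w| <= #|star (U :\: N) w| + #|N|)%N.
Proof.
move=> wN.
rewrite -(cardsID [set e : {set T} | [disjoint e & N]] (star U w)); apply: leq_add.
  apply: subset_leq_card; apply/subsetP => e; rewrite !inE.
  by move=> /andP[/and3P[-> eU ->] eN]; rewrite subsetD eU eN.
apply: (@leq_trans #|\bigcup_(x in N) [set e in H | (w \in e) && (x \in e)]|).
  apply: subset_leq_card; apply/subsetP => e; rewrite !inE.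
  move=> /andP[/pred0Pn[x /andP[xe xN]] /and3P[eH _ we]].
  by apply/bigcupP; exists x => //; rewrite inE eH we.
rewrite -[leqRHS]sum1_card; elim/big_rec2: _ => [|x c A xN]; first by rewrite cards0.
move=> hA; apply: leq_trans (leq_card_setU _ _) _; rewrite leq_add //.
apply/card_le1_eqP => e f; rewrite !inE => /and3P[eH we xe] /and3P[fH wf xf].
by apply: (linear_eq fH eH _ wf we xf xe); apply: contraNneq wN => ->.
Qed.

(** A vertex of low degree in U minus N has at most d_H edges avoiding N and |N| <= (k-1) d_H
    meeting it. The total k d_H, together with the maximum degree, is exactly D_H. *)
Lemma ex_low_star_relative W v U : (#|star W v| <= d_H H)%N ->
  U :\: cover (punctured W v) != set0 ->
  exists2 w, w \in U :\: cover (punctured W v) & (#|star U w| <= D_H k H)%N.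
Proof.
move=> vd /ex_low_star[w wU wd]; exists w => //.
rewrite /D_H leq_min star_le_max_deg andbT.
have wN : w \notin cover (punctured W v) by move: wU; rewrite inE => /andP[].
apply: leq_trans (star_le_link U wN) _; rewrite card_cover_punctured.
apply: leq_trans (leq_add wd (leq_mul (leqnn k.-1) vd)) _.
by rewrite -mulSn prednK //; lia.
Qed.

Lemma star_le_D W v : (#|star W v| <= d_H H)%N -> (#|star W v| <= D_H k H)%N.
Proof.
move=> vd; rewrite /D_H leq_min star_le_max_deg andbT.
by apply: leq_trans vd _; rewrite leq_pmull //; lia.
Qed.

Hypothesis Hconn : connector_free k H.

(** If an edge e lay inside, each y in e would lie on an edge g y through v. By linearity g y meets
    e in y alone, so these are k distinct edges and e is a connector. *)
Lemma inner_cover_punctured W v : inner (cover (punctured W v)) = set0.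
Proof.
apply/eqP; apply: contraT => /set0Pn[e]; rewrite inE => /andP[eH eN].
have vN : v \notin cover (punctured W v).
  by apply/negP => /cover_puncturedP[f _]; rewrite eqxx.
have ve : v \notin e by apply: contra vN; apply: (subsetP eN).
exfalso; apply: (Hconn (e := e)); split=> //; exists v; split=> //.
pose g y := odflt set0 [pick f in star W v | y \in f].
have gP y : y \in e -> (g y \in star W v) && (y \in g y).
  move=> /(subsetP eN)/cover_puncturedP[f fs /andP[_ yf]].
  rewrite /g; case: pickP => [f' /= -> //|/(_ f)]; by rewrite fs yf.
have g1 y : y \in e -> (#|e :&: g y| <= 1)%N.
  move=> ye; have /andP[] := gP y ye; rewrite inE => /and3P[gH _ vg] _.
  by apply: Hlin => //; apply: contraNneq ve => ->.
exists [set g y | y in e]; split.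
- apply/subsetP => _ /imsetP[y ye ->]; have /andP[] := gP y ye.
  by rewrite inE => /and3P[].
- rewrite card_in_imset ?(Hk eH) // => y z ye ze E.
  have /andP[_ yy] := gP y ye; have /andP[_ zy] := gP z ze; rewrite -E in zy.
  by have /card_le1_eqP := g1 y ye; apply; rewrite inE ?ye ?ze.
move=> _ /imsetP[y ye ->]; have /andP[gs yg] := gP y ye; split.
  by move: gs; rewrite inE => /and3P[].
apply/eqP; rewrite eqn_leq g1 //=; apply/card_gt0P; exists y.
by rewrite inE ye.
Qed.

End Structure.

(** * Partial embeddings and their one-vertex extensions *)

Section PartialEmbeddings.
Variables (T V : finType) (H : {set {set T}}) (G : {set {set V}}) (k : nat).
Implicit Types (W U N e : {set T}) (v w : T) (phi : {ffun T -> V}).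

(** A total map constrained on [W] only: the vertices outside [W] stay free, so every count is
    compared with n^{|T|}, whatever [W] is. *)
Definition pemb W phi : bool :=
  (#|phi @: W| == #|W|) && [forall e in inner H W, phi @: e \in G].

Definition link_image W v phi : {set {set V}} :=
  [set phi @: S | S : {set T} in punctured H W v].

Lemma pemb_upd W v phi x : v \in W ->
  pemb W (upd phi v x)
  = pemb (W :\ v) phi
    && (x \in common_nbhd G (link_image W v phi) :\: phi @: (W :\ v)).
Proof.
move=> vW; rewrite /pemb imset_upd_in // setUC cardsU1 (cardsD1 v W) vW.
have le := leq_imset_card phi (W :\ v).
have -> : (((x \notin phi @: (W :\ v)) + #|phi @: (W :\ v)|)%N
            == (1 + #|W :\ v|)%N)
  = (x \notin phi @: (W :\ v)) && (#|phi @: (W :\ v)| == #|W :\ v|).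
  by case: (x \in _) => /=; apply/eqP/eqP; lia.
have -> : [forall e in inner H W, upd phi v x @: e \in G]
  = [forall e in inner H (W :\ v), phi @: e \in G]
    && (x \in common_nbhd G (link_image W v phi)).
  apply/forall_inP/andP => [h|[/forall_inP h1 /bigcapP h2] e].
    split.
      apply/forall_inP => e; rewrite inE subsetD1 => /and3P[eH eW ve].
      by rewrite -(imset_upd_out phi x ve) h // inE eH.
    apply/bigcapP => _ /imsetP[_ /imsetP[e es ->] ->].
    move: es; rewrite !inE => /and3P[eH eW ve].
    by rewrite -imset_upd_in // h // inE eH.
  rewrite inE => /andP[eH eW]; case: (boolP (v \in e)) => ve.
    rewrite imset_upd_in //.
    have := h2 (phi @: (e :\ v)); rewrite inE; apply.
    by apply: imset_f; apply: imset_f; rewrite inE eH eW.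
  by rewrite imset_upd_out // h1 // inE eH subsetD1 eW.
rewrite in_setD; case: (x \in phi @: _) => /=; first by rewrite andbF.
by rewrite andbA.
Qed.

(** The value at v is resampled by [sum_upd], whence the factor |V|; on the right that coordinate is
    still free. *)
Lemma card_pemb_step (P : pred {ffun T -> V}) W v : v \in W ->
  (forall phi x, P (upd phi v x) = P phi) ->
  (#|V| * #|[set phi | P phi && pemb W phi]|
   = \sum_(phi | P phi && pemb (W :\ v) phi)
       #|common_nbhd G (link_image W v phi) :\: phi @: (W :\ v)|)%N.
Proof.
move=> vW hP.
have -> : #|[set phi | P phi && pemb W phi]|
    = (\sum_phi (P phi && pemb W phi))%N.
  rewrite -sum1_card big_mkcond /=; apply: eq_bigr => phi _.
  by rewrite inE; case: (_ && _).
rewrite -(sum_upd (fun phi => P phi && pemb W phi : nat) v) [RHS]big_mkcond /=.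
apply: eq_bigr => phi _.
under eq_bigr do rewrite hP pemb_upd // andbA.
case: (_ && _) => /=; last by rewrite big1.
rewrite -sum1_card [RHS]big_mkcond; apply: eq_bigr => x _.
by case: (x \in _).
Qed.

Hypotheses (Hk : uniform k H) (Hlin : linear_hypergraph H).

Lemma link_image_families W v phi : pemb (W :\ v) phi ->
  link_image W v phi \in families V k #|star H W v|.
Proof.
move=> /andP[/imset_injP inj _].
have sub S : S \in punctured H W v -> S \subset W :\ v.
  move=> /imsetP[e es ->]; apply: setSD.
  by move: es; rewrite inE => /and3P[].
have injS (S : {set T}) : S \in punctured H W v -> {in S &, injective phi}.
  by move=> /sub/subsetP sS x y xS yS; apply: inj; apply: sS.
rewrite inE; apply/andP; split.
  rewrite card_in_imset ?card_in_imset //; first exact: puncture_inj.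
  move=> S S' /sub/subsetP hS /sub/subsetP hS' E.
  apply/setP => u; apply/idP/idP => uS.
    have : phi u \in phi @: S' by rewrite -E imset_f.
    by case/imsetP => u' u'S' /inj -> //; [apply: hS | apply: hS'].
  have : phi u \in phi @: S by rewrite E imset_f.
  by case/imsetP => u' u'S /inj -> //; [apply: hS' | apply: hS].
apply/forall_inP => _ /imsetP[S hS ->]; rewrite card_in_imset; last exact: injS.
case/imsetP: hS => e; rewrite inE => /and3P[/Hk eH _ ve] ->.
by move: eH; rewrite (cardsD1 v) ve => <-.
Qed.

(** If the link is sent to F, its vertex set N is mapped into the cover of F, which has at most
    (k-1) r = |N| points. This leaves at most |T|^{|T|} choices on N and n^{|T|-|N|} elsewhere. *)
Lemma card_link_image_in (B : {set {set {set V}}}) W v :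
  B \subset families V k #|star H W v| ->
  (#|[set phi | link_image W v phi \in B]| * #|V| ^ (k.-1 * #|star H W v|)
   <= #|B| * #|T| ^ #|T| * #|V| ^ #|T|)%N.
Proof.
move=> /subsetP hB; set N := cover (punctured H W v).
have cN : #|N| = (k.-1 * #|star H W v|)%N by apply: card_cover_punctured.
have NT : (#|N| <= #|T|)%N by apply: max_card.
have -> : (#|V| ^ #|T| = #|V| ^ (#|T| - #|N|) * #|V| ^ #|N|)%N.
  by rewrite -expnD subnK.
rewrite -cN mulnA leq_mul2r; apply/orP; right.
apply: (@leq_trans #|\bigcup_(F in B)
   [set phi : {ffun T -> V} | [forall u in N, phi u \in cover F]]|).
  apply: subset_leq_card; apply/subsetP => phi; rewrite inE => FB.
  apply/bigcupP; exists (link_image W v phi) => //.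
  rewrite inE; apply/forall_inP => u /bigcupP[S hS uS].
  by apply/bigcupP; exists (phi @: S); apply: imset_f.
rewrite -mulnA -sum_nat_const.
elim/big_rec2: _ => [|F c A FB hA]; first by rewrite cards0.
apply: leq_trans (leq_card_setU _ _) _; rewrite leq_add // card_ffun_into.
rewrite leq_mul2r; apply/orP; right.
have cF : (#|cover F| <= #|T|)%N.
  apply: leq_trans NT; rewrite cN; have := hB F FB.
  rewrite inE => /andP[/eqP <- /forall_inP Fk].
  apply: leq_trans (leq_card_cover F) _.
  by rewrite mulnC -sum_nat_const; apply: leq_sum => S /Fk/eqP ->.
case: (posnP #|N|) => [->|N0]; first by rewrite expn0 expn_gt0 lt0n orNb.
apply: leq_trans (leq_pexp2l (leq_trans N0 NT) NT).
by rewrite leq_exp2r.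
Qed.

End PartialEmbeddings.

(** * Error bookkeeping for one extension step *)

Section Estimates.
Variable R : realFieldType.

(** Here X is a common neighbourhood size, Y what is left after deleting at most m used vertices,
    and [b] marks an atypical family, for which only 0 <= Y <= C mu is available. *)
Lemma deviation_bound (eps eta mu m C X Y : R) (b : bool) :
  1 < C -> 0 < eps -> 0 < mu -> 0 <= m -> 1 <= eta * mu ->
  0 <= Y -> Y <= X -> X <= Y + m -> X <= C * mu ->
  (~~ b -> `|X - mu| < eps * mu) ->
  `|Y - mu| <= (eps + m * eta) * mu + (if b then C * mu else 0).
Proof.
move=> C1 eps0 mu0 m0 hmu Y0 Y1 Y2 hX hb.
have hm : m <= m * eta * mu by rewrite -mulrA ler_peMr.
have em : 0 < eps * mu by rewrite mulr_gt0.
have Cm : mu < C * mu by rewrite ltr_pMl.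
rewrite ler_norml; case: b hb => [_|/(_ isT)].
  by apply/andP; split; lra.
by rewrite ltr_norml => /andP[h1 h2]; apply/andP; split; lra.
Qed.

(** A' and A are the counts before and after adding v, Z is the main term for A', and Q = p^r. The
    error of A' costs eps/4 and the step itself eps/2, using A' <= 2 Z. *)
Lemma combine_deviations (eps eps1 eps2 eta t c A A' Z Q : R) :
  0 <= Z -> 0 <= Q -> 0 < eps -> 0 <= eps1 -> 0 <= t * eta ->
  eps2 <= 1 -> eps2 <= eps / 4 ->
  2 * t * eta <= eps / 4 -> eps1 * (2 + c) = eps / 4 ->
  `|A' - Z| <= eps2 * Z ->
  `|A - A' * Q| <= Q * (A' * (eps1 + t * eta) + c * eps1 * Z) ->
  `|A - Z * Q| <= eps * (Z * Q).
Proof.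
move=> Z0 Q0 eps0 eps10 te0 e21 e24 mm eM hA' hA.
have A'2 : A' <= 2 * Z.
  move: hA'; rewrite ler_norml => /andP[_].
  have := ler_wpM2r Z0 e21; lra.
have hA'2 : `|A' * Q - Z * Q| <= Q * (eps / 4 * Z).
  rewrite -mulrBl normrM (ger0_norm Q0) mulrC ler_wpM2l //.
  by apply: le_trans hA' _; rewrite ler_wpM2r.
have hA2 : `|A - A' * Q| <= Q * (eps / 2 * Z).
  apply: le_trans hA _; rewrite ler_wpM2l //.
  have t1 : 0 <= eps1 + t * eta by rewrite addr_ge0.
  have t2 := ler_wpM2r t1 A'2.
  have t3 := ler_wpM2r Z0 mm.
  have t4 : eps1 * (2 + c) * Z = eps / 4 * Z by rewrite eM.
  lra.
have -> : A - Z * Q = (A - A' * Q) + (A' * Q - Z * Q) by ring.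
apply: le_trans (ler_normD _ _) _.
have : 0 <= Q * (eps * Z) by rewrite !mulr_ge0 // ltW.
lra.
Qed.

End Estimates.

(** * Upper bound for completing a prescribed partial map *)

Section Extension.
Variables (R : realType) (T V : finType) (H : {set {set T}}).
Variables (G : {set {set V}}) (k D : nat) (C eta p : R).
Variables (N : {set T}) (P : pred {ffun T -> V}).
Hypotheses (hC : 1 < C) (adm : admissible k D C eta p G).
Hypothesis Hk : uniform k H.
Hypothesis N_indep : inner H N = set0.
Hypothesis P_upd : forall w phi x, w \notin N -> P (upd phi w x) = P phi.
Hypothesis low : forall U : {set T}, U :\: N != set0 ->
  exists2 w, w \in U :\: N & (#|star H U w| <= D)%N.

(** Peeling off a low-degree vertex outside N costs C n p^s by BDD, with s its number of edges in U,
    and the n cancels against the freed coordinate. At U = N no edge remains, so the full power of p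
    has been collected. *)
Lemma card_pemb_extend (U : {set T}) : N \subset U ->
  #|[set phi | P phi && pemb H G U phi]|%:R
    <= C ^+ #|U :\: N| * p ^+ #|inner H U| * #|[set phi | P phi]|%:R.
Proof.
have [_ _ /andP[p0 _] hn _] := adm.
have C0 : 0 <= C := C_ge0 hC.
have n0 : 0 < #|V|%:R :> R.
  rewrite ltr0n lt0n; apply/eqP => V0; move: hn.
  by rewrite V0 mulr0 ler10.
have [j] := ubnP #|U :\: N|; elim: j U => // j IH U ltU NU.
have [UN0|UN0] := eqVneq (U :\: N) set0.
  have -> : U = N.
    by apply/eqP; rewrite eqEsubset NU -setD_eq0 UN0 eqxx.
  rewrite setDv N_indep !cards0 !expr0 !mul1r ler_nat subset_leq_card //.
  by apply/subsetP => phi; rewrite !inE => /andP[].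
have [w wUN wD] := low UN0.
have /andP[wN wU] : (w \notin N) && (w \in U) by move: wUN; rewrite inE.
have UwN : (U :\ w) :\: N = (U :\: N) :\ w by rewrite setDDl setUC -setDDl.
have cU : #|U :\: N| = (#|(U :\ w) :\: N|).+1 by rewrite UwN (cardsD1 w) wUN.
have NUw : N \subset U :\ w by rewrite subsetD1 NU.
have {}IH := IH (U :\ w); rewrite -ltnS -cU in IH; have {}IH := IH ltU NUw.
rewrite -(ler_pM2l n0) -natrM (card_pemb_step H G wU); last first.
  by move=> phi x; apply: P_upd.
rewrite natr_sum.
apply: (@le_trans _ _ (\sum_(phi | P phi && pemb H G (U :\ w) phi)
    (C * #|V|%:R * p ^+ #|star H U w|))).
  apply: ler_sum => phi /andP[_ hphi].
  apply: le_trans (_ : #|common_nbhd G (link_image H U w phi)|%:R <= _).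
    by rewrite ler_nat subset_leq_card // subsetDl.
  by apply: (admissible_BDD hC adm wD); apply: link_image_families hphi.
rewrite sumr_const -[_ *+ _]mulr_natl -cardsE cU (card_inner H wU) exprS exprD.
have E (a b c d f g : R) : a * (b * c * (d * f) * g) = c * d * g * (b * a * f).
  by ring.
by rewrite E ler_wpM2r // !mulr_ge0 ?exprn_ge0.
Qed.

End Extension.

(** * The induction over the vertices of [H] *)

Section Counting.
Variables (R : realType) (k : nat) (C : R) (T : finType) (H : {set {set T}}).
Hypotheses (k2 : (2 <= k)%N) (hC : 1 < C) (Hk : uniform k H).
Hypotheses (Hlin : linear_hypergraph H) (Hconn : connector_free k H).

Section Step.
Variables (V : finType) (G : {set {set V}}) (p eta eps : R).
Variables (W : {set T}) (v : T).
Hypotheses (adm : admissible k (D_H k H) C eta p G) (vW : v \in W).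
Hypothesis vlow : (#|star H W v| <= d_H H)%N.
Local Notation n := (#|V|%:R : R).
Local Notation m := #|T|.
Local Notation r := #|star H W v|.

Let eta0 : 0 < eta := admissible_eta_gt0 adm.

Let C0 : 0 <= C := C_ge0 hC.

Let n0 : 0 < n.
Proof.
have [_ _ _ hn _] := adm; rewrite ltr0n lt0n; apply/eqP => V0; move: hn.
by rewrite V0 mulr0 ler10.
Qed.

Lemma card_pemb_atypical : 0 < eps ->
  #|atypical k G r eps p|%:R <= eps * n ^+ (k.-1 * r) ->
  #|[set phi | (link_image H W v phi \in atypical k G r eps p)
               && pemb H G (W :\ v) phi]|%:R
    <= C ^+ m * m%:R ^+ m * eps * (n ^+ m * p ^+ #|inner H (W :\ v)|).
Proof.
move=> eps0 rare; have [_ _ /andP[p0 _] hn _] := adm.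
set N := cover (punctured H W v).
have NW : N \subset W :\ v.
  apply/subsetP => u /cover_puncturedP[e]; rewrite !inE.
  by move=> /and3P[_ /subsetP eW _] /andP[-> /eW].
have ext := @card_pemb_extend R T V H G k (D_H k H) C eta p N
  (fun phi => link_image H W v phi \in atypical k G r eps p) hC adm Hk
  (inner_cover_punctured Hk Hlin Hconn W v) _
  (fun U => ex_low_star_relative Hk k2 Hlin vlow) (W :\ v) NW.
apply: le_trans (ext _) _ => [w phi x wN|].
  suff -> : link_image H W v (upd phi w x) = link_image H W v phi by [].
  apply: eq_in_imset => S hS; apply: imset_upd_out.
  by apply: contra wN => wS; apply/bigcupP; exists S.
set B := [set phi | _].
have hB : #|B|%:R <= eps * (m%:R ^+ m * n ^+ m).
  have nk : 0 < n ^+ (k.-1 * r) by rewrite exprn_gt0.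
  rewrite -(ler_pM2r nk).
  apply: (@le_trans _ _ (#|atypical k G r eps p| * m ^ m * #|V| ^ m)%:R).
    rewrite -natrX -natrM ler_nat; apply: card_link_image_in => //.
    by apply/subsetP => F; rewrite inE => /andP[].
  rewrite !natrM !natrX -mulrA.
  have mn0 : 0 <= m%:R ^+ m * n ^+ m by rewrite mulr_ge0 ?exprn_ge0.
  by apply: le_trans (ler_wpM2r mn0 rare) _; rewrite mulrAC.
have hCm : C ^+ #|(W :\ v) :\: N| <= C ^+ m.
  by apply: ler_weXn2l; [exact: ltW | exact: max_card].
have q0 : 0 <= p ^+ #|inner H (W :\ v)| by rewrite exprn_ge0.
apply: le_trans (_ : C ^+ m * p ^+ #|inner H (W :\ v)| * #|B|%:R <= _).
  by rewrite ler_wpM2r // ler_wpM2r.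
apply: le_trans (ler_wpM2l _ hB) _; first by rewrite mulr_ge0 ?exprn_ge0.
have E (a b c d f : R) : a * b * (c * (d * f)) = a * d * c * (f * b) by ring.
by rewrite E.
Qed.

Lemma extension_deviation (phi : {ffun T -> V}) : 0 < eps ->
  pemb H G (W :\ v) phi ->
  `| #|common_nbhd G (link_image H W v phi) :\: phi @: (W :\ v)|%:R - n * p ^+ r |
  <= (eps + m%:R * eta) * (n * p ^+ r)
     + (if link_image H W v phi \in atypical k G r eps p
        then C * (n * p ^+ r) else 0).
Proof.
move=> eps0 hphi; have fam := link_image_families Hk hphi.
have rD := star_le_D k2 vlow.
have hX := admissible_BDD hC adm rD fam.
have := admissible_exp adm rD; set mu := n * p ^+ r => hmu.
have mu0 : 0 < mu by rewrite -(pmulr_rgt0 _ eta0); apply: lt_le_trans ltr01 hmu.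
set F := link_image H W v phi in fam hX *.
have im : (#|phi @: (W :\ v)| <= m)%N.
  by apply: leq_trans (leq_imset_card _ _) (max_card _).
apply: (@deviation_bound _ _ _ _ _ _ #|common_nbhd G F|%:R) => //.
- by rewrite ler_nat subset_leq_card // subsetDl.
- rewrite -natrD ler_nat -(cardsID (phi @: (W :\ v)) (common_nbhd G F)) addnC.
  rewrite leq_add2l; apply: leq_trans im.
  by rewrite subset_leq_card // subsetIr.
- by rewrite mulrA.
by rewrite inE fam negbK -mulrA.
Qed.

(** Summing the deviation over partial embeddings, typical ones give a relative error, and each
    atypical one costs at most an extra C n p^r; [card_pemb_atypical] bounds their number. *)
Lemma card_pemb_deviation : 0 < eps ->
  #|atypical k G r eps p|%:R <= eps * n ^+ (k.-1 * r) ->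
  `| #|[set phi | pemb H G W phi]|%:R
     - #|[set phi | pemb H G (W :\ v) phi]|%:R * p ^+ r |
  <= p ^+ r * (#|[set phi | pemb H G (W :\ v) phi]|%:R * (eps + m%:R * eta)
       + C ^+ m.+1 * m%:R ^+ m * eps * (n ^+ m * p ^+ #|inner H (W :\ v)|)).
Proof.
move=> eps0 rare; have [_ _ /andP[p0 _] hn _] := adm.
set A' := [set phi | pemb H G (W :\ v) phi].
rewrite -(ler_pM2l n0) -{1}(gtr0_norm n0) -normrM mulrBr -natrM.
have := @card_pemb_step T V H G predT W v vW (fun _ _ => erefl).
have -> : [set phi | predT phi && pemb H G W phi] = [set phi | pemb H G W phi].
  by apply/setP => phi; rewrite !inE.
move=> ->; rewrite natr_sum (eq_bigl (mem A')); last first.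
  by move=> phi; rewrite /= inE.
have -> : n * (#|A'|%:R * p ^+ r) = \sum_(phi in A') (n * p ^+ r).
  by rewrite sumr_const -[_ * _ *+ _]mulr_natl mulrCA.
rewrite -sumrB; apply: le_trans (ler_norm_sum _ _ _) _.
apply: (@le_trans _ _ (\sum_(phi in A') ((eps + m%:R * eta) * (n * p ^+ r)
   + (if link_image H W v phi \in atypical k G r eps p
      then C * (n * p ^+ r) else 0)))).
  apply: ler_sum => phi hphi; apply: extension_deviation => //.
  by move: (hphi : phi \in A'); rewrite in_set.
rewrite big_split /= -big_mkcondr /= !sumr_const.
rewrite -[_ * (n * _) *+ _]mulr_natl -[C * (n * _) *+ _]mulr_natl.
have := card_pemb_atypical eps0 rare.
set b := #|[set _ | _]|; set Z := n ^+ m * _ => hb.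
have -> : #|[pred phi in A' | link_image H W v phi \in atypical k G r eps p]| = b.
  by apply: eq_card => phi; rewrite !inE andbC.
have Cn : 0 <= C * (n * p ^+ r) by rewrite !mulr_ge0 ?exprn_ge0.
have := ler_wpM2r Cn hb.
have E (a a' c d f g h i : R) : a * (a' * (c * d + f * g * h * i))
    = c * (d * (a * a')) + g * h * i * (f * (a * a')) by ring.
by rewrite exprS -[C * C ^+ _ * _]mulrA E lerD2l mulrA.
Qed.

End Step.

Lemma card_pemb_asymp (W : {set T}) (eps : R) : 0 < eps ->
  exists2 eta : R, 0 < eta &
  forall (V : finType) (G : {set {set V}}) (p : R),
    admissible k (D_H k H) C eta p G ->
    `| #|[set phi | pemb H G W phi]|%:R
       - #|V|%:R ^+ #|T| * p ^+ #|inner H W| |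
    <= eps * (#|V|%:R ^+ #|T| * p ^+ #|inner H W|).
Proof.
have [j] := ubnP #|W|; elim: j W eps => // j IH W eps cardW eps0.
have [W0|W0] := eqVneq W set0.
  exists 1 => // V G p _; rewrite W0.
  have -> : inner H set0 = set0.
    apply/setP => e; rewrite !inE subset0; apply/negP => /andP[eH /eqP e0].
    by have := Hk eH; rewrite e0 cards0; lia.
  have -> : [set phi : {ffun T -> V} | pemb H G set0 phi] = setT.
    apply/setP => phi; rewrite !inE /pemb imset0 !cards0 /=.
    apply/forall_inP => e; rewrite inE subset0 => /andP[eH /eqP e0].
    by have := Hk eH; rewrite e0 cards0; lia.
  rewrite cards0 cardsT card_ffun natrX expr0 mulr1 subrr normr0.
  by rewrite mulr_ge0 ?exprn_ge0 // ltW.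
have [v vW vlow] := ex_low_star H W0.
have C0 : 0 <= C := C_ge0 hC.
set M : R := 2 + C ^+ #|T|.+1 * #|T|%:R ^+ #|T|.
have M0 : 0 < M by rewrite ltr_wpDr // mulr_ge0 ?exprn_ge0.
(* M is 2 + c, with c the constant in front of the atypical term, so that eps1 (2 + c) = eps/4. *)
set eps1 := eps / 4 / M; have eps10 : 0 < eps1 by rewrite !divr_gt0.
set eps2 := Num.min 1 (eps / 4).
have eps20 : 0 < eps2 by rewrite lt_min ltr01 divr_gt0.
have cardW' : (#|W :\ v| < j)%N by move: cardW; rewrite (cardsD1 v) vW.
have [eta1 eta10 h1] := IH (W :\ v) eps2 cardW' eps20.
have [eta2 eta20 h2] := atypical_rare k2 hC (star_le_D k2 vlow) eps10.
(* Gives 2 |T| eta <= eps/4; the added 1 keeps d positive even for empty T. *)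
set d : R := 2 * #|T|%:R + 1; have d0 : 0 < d by rewrite ltr_wpDl // mulr_ge0.
pose eta := Num.min (eps / 4 / d) (Num.min eta1 eta2).
exists eta; first by rewrite !lt_min eta10 eta20 !divr_gt0.
move=> V G p adm; have [_ _ /andP[p0 _] hn _] := adm.
have le1 : eta <= eta1 by rewrite !ge_min lexx !orbT.
have le2 : eta <= eta2 by rewrite !ge_min lexx !orbT.
have le3 : eta <= eps / 4 / d by rewrite !ge_min lexx.
have hA := card_pemb_deviation adm vW vlow eps10 (h2 V G p (admissible_le le2 adm)).
have hA' := h1 V G p (admissible_le le1 adm).
rewrite (card_inner H vW) exprD mulrA.
apply: (combine_deviations _ _ _ _ _ _ _ _ _ hA' hA) => //.
- by rewrite mulr_ge0 ?exprn_ge0.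
- by rewrite exprn_ge0.
- exact: ltW.
- by rewrite mulr_ge0 // ltW // (admissible_eta_gt0 adm).
- by rewrite ge_min lexx.
- by rewrite ge_min lexx orbT.
- apply: (@le_trans _ _ (d * eta)).
    by rewrite ler_pM2r ?(admissible_eta_gt0 adm) // /d lerDl.
  by rewrite mulrC -ler_pdivlMr.
- by rewrite /eps1 divfK // gt_eqF.
Qed.

End Counting.

(** * Passage to the asymptotic statement *)

Lemma D_H_gt0 (T : finType) (H : {set {set T}}) (k : nat) (e : {set T}) :
  (2 <= k)%N -> uniform k H -> e \in H -> (0 < D_H k H)%N.
Proof.
move=> k2 Hk eH.
have e0 : e != set0 by rewrite -card_gt0 (Hk e eH); lia.
have [v ve vlow] := ex_low_star H e0.
apply: leq_trans (star_le_D k2 vlow); apply/card_gt0P; exists e.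
by rewrite inE eH subxx.
Qed.

Lemma inner_setT (T : finType) (H : {set {set T}}) : inner H setT = H.
Proof. by apply/setP => e; rewrite inE subsetT andbT. Qed.

Lemma embeddingsE (T V : finType) (H : {set {set T}}) (G : {set {set V}}) :
  embeddings H G = [set phi | pemb H G setT phi].
Proof.
apply/setP => phi; rewrite !inE /pemb inner_setT; congr (_ && _).
apply/injectiveP/imset_injP => [inj x y _ _|inj x y]; first exact: inj.
by apply: inj; rewrite inE.
Qed.

Lemma le_mul_exp_of_le_mul (R : realType) (p x y : R) (D : nat) :
  (0 < D)%N -> 1 <= y -> y <= p * x -> y <= p ^+ D * x ^+ D.
Proof.
move=> D0 y1 yx; rewrite -exprMn.
apply: le_trans (_ : y ^+ D <= _); first by rewrite ler_eXnr.
by apply: lerXn2r => //; rewrite nnegrE; lra.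
Qed.

From mathcomp Require Import all_classical all_reals all_analysis.

Import numFieldNormedType.Exports.

Local Open Scope classical_set_scope.
Local Open Scope ring_scope.

Theorem theorem1p4 (R : realType) (k m : nat) (eps C : R)
    (T : finType) (H : {set {set T}})
    (hk : (2 <= k)%N) (hm : (4 <= m)%N) (heps : 0 < eps) (hC : 1 < C)
    (hT : #|T| = m) (hunif : uniform k H) (hlin : linear_hypergraph H)
    (hconn : connector_free k H) :
  exists delta : R, 0 < delta /\
  forall p : nat -> R,
    ((0 < D_H k H)%N ->
       p n * n%:R `^ ((D_H k H)%:R^-1) @[n --> \oo] --> +oo) ->
    p n @[n --> \oo] --> (0 : R) ->
  exists n0 : nat, forall n : nat, (n0 <= n)%N ->
  forall (V : finType) (G : {set {set V}}),
    #|V| = n -> uniform k G ->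
    pseudorandom k G (D_H k H) C 2 delta (p n) ->
    `| #|embeddings H G|%:R - n%:R ^+ m * p n ^+ #|H| |
      < eps * (n%:R ^+ m * p n ^+ #|H|).
Proof.
have eps20 : 0 < eps / 2 by rewrite divr_gt0.
(* Half of [eps] is used because the count gives a weak inequality and a strict one is required. *)
have [eta eta0 hcount] := card_pemb_asymp hk hC hunif hlin hconn finset.setT eps20.
exists eta; split=> // p hpD hp0.
set D := D_H k H in hpD hcount *.
(* M >= 1 is needed for M <= M^D when the bound on p n^{1/D} is raised to the power D. *)
set M : R := Num.max 1 eta^-1.
have evD : \forall n \near \oo,
    (0 < D)%N -> M <= p n * n%:R `^ (D%:R^-1).
  case: (posnP D) => [->|D0]; first by apply: nearW.
  by have /cvgryPge/(_ M) := hpD D0; apply: filterS.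
have [n1 _ h1] := filterI evD (cvgr_lt 0 hp0 1 ltr01).
exists (maxn (maxn n1 k) (Num.truncn M).+1) => n.
rewrite !geq_max => /andP[/andP[n1n kn] Mn] V G Vn Gk hG.
have [hMD p1] := h1 n n1n.
have M1 : 1 <= M by rewrite le_max lexx.
have Mn' : M <= n%:R.
  by apply/ltW; rewrite -truncn_lt_nat // (le_trans ler01 M1).
have etaM : 1 <= eta * M.
  rewrite -(divff (lt0r_neq0 eta0)) ler_pM2l // le_max lexx orbT //.
have n0 : 0 < n%:R :> R by apply: lt_le_trans Mn'; lra.
(* The sign of p is read off the edge count of G, as C(n, k) > 0 for n >= k. *)
have p0 : 0 <= p n.
  have [hE _ _] := hG; have : 0 <= #|G|%:R :> R by [].
  by rewrite hE pmulr_lge0 // ltr0n bin_gt0 Vn.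
have adm : admissible k D C eta (p n) G.
  split=> //; rewrite ?p0 ?(ltW p1) // Vn.
    by apply: le_trans etaM _; rewrite ler_pM2l.
  apply: le_trans etaM _; rewrite ler_pM2l //.
  case: (posnP D) hMD => [->|D0 /(_ isT) hMD]; first by rewrite expr0 mulr1.
  have := le_mul_exp_of_le_mul D0 M1 hMD.
  rewrite -[(_ `^ _) ^+ _]powR_mulrn ?powR_ge0 // -powRrM.
  by rewrite mulVf ?pnatr_eq0 -?lt0n // powRr1 // mulrC.
have := hcount V G (p n) adm; rewrite -embeddingsE inner_setT Vn hT => h.
apply: le_lt_trans h _; rewrite ltr_pM2r; first lra.
rewrite mulr_gt0 ?(exprn_gt0 _ n0) //.
(* The main term must be positive: without edges the power of p is 1, and with an edge D_H > 0
   forces p > 0. *)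
have [->|[e eH]] := set_0Vmem H; first by rewrite cards0 expr0.
by rewrite exprn_gt0 // (admissible_p_gt0 adm) // (D_H_gt0 hk hunif eH).
Qed.
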